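(* Let $r\geq 3$ be an integer and let $G$ be a finite, undirected graph without loops or multiple edges such that $\Delta(G)-\delta(G)\leq 1$ and $\chi'(G)=\Delta(G)=r$. Let $n=|V(G)|$ and $n_r=|\{v\in V(G): d_G(v)=r\}|$. Then $$\Sigma'(G)\leq \left\lfloor\frac{2n_r(2r-1)+n(r-1)(r^2+2r-2)}{4r}\right\rfloor,$$ where $\Sigma'(G)$ is the edge-chromatic sum of $G$.
   Context: All graphs are finite, undirected, without loops or multiple edges. $V(G)$ and $E(G)$ are the vertex and edge sets of $G$, $d_G(v)$ is the degree of a vertex $v$, $\Delta(G)$ and $\delta(G)$ are the maximum and minimum vertex degrees, and $\chi'(G)$ is the chromatic index (the least number of colors in a proper edge-coloring of $G$). A proper edge-coloring of $G$ is a map $\alpha:E(G)\to\mathbb{N}$ (positive integers) with $\alpha(e)\neq\alpha(e')$ for every pair of adjacent edges $e,e'$. For a proper edge-coloring $\alpha$ of $G$, $\Sigma'(G,\alpha)=\sum_{e\in E(G)}\alpha(e)$ is the sum of the colors of the edges of $G$. The edge-chromatic sum of $G$ is $\Sigma'(G)=\min_{\alpha}\Sigma'(G,\alpha)$, the minimum being over all proper edge-colorings $\alpha$ of $G$ (with any number of colors). *)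

(* Defs.v *)
From mathcomp Require Import all_boot.
From mathcomp Require Import boolp.

Set Implicit Arguments.
Unset Strict Implicit.
Unset Printing Implicit Defensive.

Record sgraph := SGraph {
  vertex :> finType;
  adj : rel vertex;
  adj_sym : symmetric adj;
  adj_irrefl : irreflexive adj }.

Section Graph.

Variable G : sgraph.

Definition edges : {set {set G}} :=
  [set [set p.1; p.2] | p : G * G & adj p.1 p.2].

Definition degree (v : G) : nat := #|[set w | adj v w]|.

Definition max_degree : nat := \max_(v : G) degree v.

(* The default value [max_degree] is an upper bound of all degrees, so it only
   plays a role for the graph without vertices. *)
Definition min_degree : nat := \big[minn/max_degree]_(v : G) degree v.

(* A coloring is given by a function on all vertex sets; its values outside
   [edges] are never taken into account. *)
Definition proper_edge_coloring (alpha : {set G} -> nat) : Prop :=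
  (forall f, f \in edges -> 0 < alpha f) /\
  (forall f g, f \in edges -> g \in edges ->
     f != g -> f :&: g != set0 -> alpha f != alpha g).

Definition num_colors (alpha : {set G} -> nat) : nat :=
  size (undup [seq alpha f | f <- enum edges]).

Definition color_sum (alpha : {set G} -> nat) : nat :=
  \sum_(f in edges) alpha f.

Lemma exists_proper_edge_coloring : exists alpha, proper_edge_coloring alpha.
Proof.
exists (fun f => (enum_rank f).+1); split=> // f g _ _ fNg _.
by rewrite eqSS; apply: contra_neq fNg => /ord_inj/enum_rank_inj.
Qed.

Lemma exists_coloring_value (m : ({set G} -> nat) -> nat) :
  exists k, `[< exists2 alpha, proper_edge_coloring alpha & m alpha = k >].
Proof.
have [alpha alphaP] := exists_proper_edge_coloring.
by exists (m alpha); apply/asboolP; exists alpha.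
Qed.

(* The minimum of the numbers [m alpha] over all proper edge-colorings. *)
Definition coloring_min (m : ({set G} -> nat) -> nat) : nat :=
  ex_minn (exists_coloring_value m).

Definition chromatic_index : nat := coloring_min num_colors.

Definition edge_chromatic_sum : nat := coloring_min color_sum.

Lemma coloring_min_attained (m : ({set G} -> nat) -> nat) :
  exists2 alpha, proper_edge_coloring alpha & m alpha = coloring_min m.
Proof. by rewrite /coloring_min; case: ex_minnP => k /asboolP. Qed.

Lemma coloring_min_le (m : ({set G} -> nat) -> nat) alpha :
  proper_edge_coloring alpha -> coloring_min m <= m alpha.
Proof.
rewrite /coloring_min => alphaP; case: ex_minnP => k _; apply.
by apply/asboolP; exists alpha.
Qed.

End Graph.

(* Main.v *)
(* Reversing the colors [1, ..., k] of a proper edge-coloring with [k] colors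
   gives a second one, and the two color sums add up to [(k + 1) |E(G)|]; so one
   of them is at most [(k + 1) |E(G)| / 2].  With [2 |E(G)| <= n (r - 1) + n_r],
   the case [k = r] gives a bound which is [(r - 1) (r - 2) (n - n_r) / (4 r)]
   below the claimed one. *)
Require Import Defs.
From mathcomp Require Import all_boot.
From mathcomp Require Import zify.

Lemma card_edge (G : sgraph) (f : {set G}) : f \in edges G -> #|f| = 2.
Proof.
case/imsetP=> -[x y]; rewrite inE /= => xy ->; rewrite cards2.
by case: eqVneq xy => // ->; rewrite adj_irrefl.
Qed.

(** Sending a neighbor [w] of [v] to [[set v; w]] is a bijection onto the edges at [v]; injectivity
    uses that [w] differs from [v], as there are no loops. *)
Lemma card_incident_edges (G : sgraph) (v : G) :
  #|[set f in edges G | v \in f]| = degree v.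
Proof.
rewrite /degree -(@card_in_imset _ _ (fun w => [set v; w])); last first.
  move=> w w'; rewrite !inE => vw vw' /setP/(_ w); rewrite !inE eqxx orbT.
  by case: eqVneq vw => [->|_ _ /esym/eqP //]; rewrite adj_irrefl.
apply: eq_card => f; rewrite inE; apply/andP/imsetP => [[]|[w]].
  case/imsetP=> -[x y]; rewrite inE /= => xy ->; rewrite !inE.
  case/orP=> /eqP->; first by exists y; rewrite ?inE.
  by exists x; rewrite ?inE 1?adj_sym // setUC.
rewrite inE => vw ->; rewrite !inE eqxx; split=> //.
by apply/imsetP; exists (v, w); rewrite ?inE.
Qed.

(** Double counting of the pairs of an edge and one of its endpoints. *)
Lemma handshake (G : sgraph) : \sum_(v : G) degree v = 2 * #|edges G|.
Proof.
rewrite mulnC -sum_nat_const.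
under eq_bigr do rewrite -card_incident_edges -sum1_card.
under [RHS]eq_bigr => f fE do rewrite -(card_edge G f fE) -sum1_card.
rewrite (exchange_big_dep (mem (edges G))) /=; last first.
  by move=> v f _; rewrite inE => /andP[].
by apply: eq_bigr => f fE; apply: eq_bigl => v; rewrite inE fE.
Qed.

Lemma edge_chromatic_sum_num_colors (G : sgraph) (alpha : {set G} -> nat) :
  proper_edge_coloring alpha ->
  2 * edge_chromatic_sum G <= (num_colors alpha).+1 * #|edges G|.
Proof.
(* The colors used by [alpha] may have gaps. Their positions in the duplicate-free list [s] renumber
   them from 0 to [num_colors alpha - 1]. *)
case=> _ alphaP; set s := undup [seq alpha f | f <- enum (edges G)].
have alpha_s f : f \in edges G -> alpha f \in s.
  by move=> fE; rewrite mem_undup map_f // mem_enum.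
have idx_lt f : f \in edges G -> index (alpha f) s < num_colors alpha.
  by move=> fE; rewrite index_mem alpha_s.
have idxP f g : f \in edges G -> g \in edges G -> f != g ->
    f :&: g != set0 -> index (alpha f) s != index (alpha g) s.
  move=> fE gE fNg fIg; apply: contra_neq (alphaP f g fE gE fNg fIg).
  exact: (index_inj 0) (alpha_s f fE) (alpha_s g gE).
(* Both colorings take values between 1 and [num_colors alpha], and on every edge they add up to
   [(num_colors alpha).+1]. *)
pose up f := (index (alpha f) s).+1.
pose down f := num_colors alpha - index (alpha f) s.
have upP : proper_edge_coloring up by split.
have downP : proper_edge_coloring down.
  split=> [f fE|f g fE gE fNg fIg]; first by rewrite subn_gt0 idx_lt.
  (* The bounds on the indices keep the truncated subtraction in [down] injective. *)
  have := idxP f g fE gE fNg fIg; have := idx_lt f fE; have := idx_lt g gE.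
  by rewrite /down; lia.
have sumE : color_sum up + color_sum down = (num_colors alpha).+1 * #|edges G|.
  rewrite -big_split /= mulnC -sum_nat_const; apply: eq_bigr => f fE.
  by rewrite /up /down addSn subnKC // ltnW // idx_lt.
by rewrite -sumE mul2n -addnn leq_add // coloring_min_le.
Qed.

(** Every vertex contributes at most [k], plus one more exactly when its degree is [k.+1]. *)
Lemma sum_degree_le (G : sgraph) (k : nat) : max_degree G <= k.+1 ->
  \sum_(v : G) degree v <= #|G| * k + #|[set v : G | degree v == k.+1]|.
Proof.
move=> maxG; rewrite -sum_nat_const -sum1dep_card [X in _ + X]big_mkcond -big_split /=.
rewrite [leqRHS](eq_bigr (fun v => k + (degree v == k.+1))); last first.
  by move=> v _; case: eqP.
apply: leq_sum => v _.
have : degree v <= k.+1 by apply: leq_trans maxG; apply: leq_bigmax.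
lia.
Qed.

Theorem corollary2 (r : nat) (G : sgraph)
    (hr : 3 <= r)
    (hdeg : max_degree G - min_degree G <= 1)
    (hchi : chromatic_index G = max_degree G)
    (hmax : max_degree G = r) :
  let n := #|G| in
  let n_r := #|[set v : G | degree v == r]| in
  edge_chromatic_sum G <=
    (2 * n_r * (2 * r - 1) + n * (r - 1) * (r ^ 2 + 2 * r - 2)) %/ (4 * r).
Proof.
have [alpha alphaP alphaE] := coloring_min_attained (@num_colors G).
have := edge_chromatic_sum_num_colors G alpha alphaP.
rewrite alphaE -/(chromatic_index _) hchi hmax => {alpha alphaP alphaE}.
case: r hr hmax => [//|k] hr hmax; have := handshake G.
have := sum_degree_le G k; rewrite hmax => /(_ (leqnn _)); cbv zeta.
have := max_card [set v : G | degree v == k.+1].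
move: #|G| #|[set v | _]| => n m.
move: (edge_chromatic_sum G) #|edges G| (\sum_v _) => S e D m_le Dle De Sle.
rewrite leq_divRL //.
(* Double [Sle] and replace [2 * e] by the degree sum [D], which [Dle] bounds. *)
have S_le : S * 4 <= k.+2 * (n * k + m) by nia.
have : S * (4 * k.+1) <= k.+1 * (k.+2 * (n * k + m)) by nia.
move/leq_trans; apply.
case: k hr {hmax S_le Sle De Dle} => [//|k] _.
(* Now [r] is [k.+2]. After writing [n = m + d], the coefficients of [m] on the two sides agree, and
   those of [d] differ by [k.+1 * k]. *)
move/subnKC: m_le => <-; move: (n - m) => d.
have -> : 2 * k.+2 - 1 = 2 * k + 3 by lia.
have -> : k.+2 ^ 2 + 2 * k.+2 - 2 = k * k + 6 * k + 6 by rewrite expnS expn1; lia.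
by rewrite subn1 /=; nia.
Qed.
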